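(* Let $p$ be a prime. For each $n\ge 1$ let $\Sigma_n=(\sigma_{n,1},\ldots,\sigma_{n,n})$ be an $n$-tuple of subsets of $[n]=\{1,\ldots,n\}$, let $|\Sigma_n|=\sum_{i=1}^n|\sigma_{n,i}|$, and let $X_n$ be a Haar-random $n\times n$ matrix over $\mathbb{Z}_p$ supported on $\Sigma_n$. If $\mathrm{cok}(X_n)$ converges to CL, then $$\lim_{n\to\infty}\left(\frac{|\Sigma_n|}{n}-\log_p n\right)=\infty.$$
   Context: A random matrix $X_n\in \mathrm{M}_n(\mathbb{Z}_p)$ is a Haar-random matrix supported on $\Sigma_n=(\sigma_{n,1},\ldots,\sigma_{n,n})$ if $(X_n)_{i,j}=0$ whenever $i\notin\sigma_{n,j}$, and the entries $(X_n)_{i,j}$ with $i\in\sigma_{n,j}$ are independent and distributed according to the Haar probability measure on $\mathbb{Z}_p$. We say $\mathrm{cok}(X_n)$ converges to CL if for every finite abelian $p$-group $H$, $\lim_{n\to\infty}\mathbb{P}(\mathrm{cok}(X_n)\cong H)=\frac{1}{|\mathrm{Aut}(H)|}\prod_{i=1}^\infty(1-p^{-i})$. *)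

(* Defs.v *)
From HB Require Import structures.
From mathcomp Require Import all_boot all_order all_algebra all_fingroup all_solvable.
From mathcomp Require Import all_classical all_reals all_analysis.

Set Implicit Arguments.
Unset Strict Implicit.
Unset Printing Implicit Defensive.

Import Order.TTheory GRing.Theory Num.Theory.
Import numFieldNormedType.Exports.

Local Open Scope classical_set_scope.
Local Open Scope ring_scope.

(* The ring of p-adic integers as the inverse limit of the rings Z/p^(k+1).
   The index starts at Z/p because 'Z_1 is not the zero ring in MathComp. *)
Record padic_int (p : nat) := PadicInt {
  padic_proj : forall k : nat, 'Z_(p ^ k.+1);
  padic_compat :
    forall k, (nat_of_ord (padic_proj k.+1))%:R = padic_proj k }.

Coercion padic_proj : padic_int >-> Funclass.

Section PadicRing.
Variable p : nat.
Implicit Types x y z : padic_int p.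

HB.instance Definition _ := gen_eqMixin (padic_int p).
HB.instance Definition _ := gen_choiceMixin (padic_int p).

Lemma padic_ext x y : (forall k, x k = y k) -> x = y.
Proof.
case: x y => [f Hf] [g Hg] /= fg.
have efg : f = g by apply: functional_extensionality_dep.
by subst g; congr PadicInt; apply: Prop_irrelevance.
Qed.

Lemma padic_dvd k :
  ((Zp_trunc (p ^ k.+1)).+2 %| (Zp_trunc (p ^ k.+2)).+2)%N.
Proof.
case: p => [|[|q]]; first by rewrite !exp0n.
  by rewrite !exp1n.
by rewrite !Zp_cast ?dvdn_exp2l // -{1}(expn0 q.+2) ltn_exp2l.
Qed.

Lemma padic_redP k (a : nat) (b : 'Z_(p ^ k.+2)) :
  a = b %[mod (Zp_trunc (p ^ k.+2)).+2] ->
  a%:R = (nat_of_ord b)%:R :> 'Z_(p ^ k.+1).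
Proof.
move=> ab; apply: val_inj; rewrite /= !Zp_nat /=.
by rewrite -(modn_dvdm _ (padic_dvd k)) ab modn_dvdm // padic_dvd.
Qed.

Fact padic_zero_compat k :
  (nat_of_ord (0 : 'Z_(p ^ k.+2)))%:R = 0 :> 'Z_(p ^ k.+1).
Proof. by []. Qed.

Fact padic_one_compat k :
  (nat_of_ord (1 : 'Z_(p ^ k.+2)))%:R = 1 :> 'Z_(p ^ k.+1).
Proof. by []. Qed.

Fact padic_add_compat x y k :
  (nat_of_ord (x k.+1 + y k.+1))%:R = x k + y k.
Proof.
rewrite -(padic_compat x k) -(padic_compat y k) -natrD; apply/esym/padic_redP.
by rewrite /= modn_mod.
Qed.

Fact padic_mul_compat x y k :
  (nat_of_ord (x k.+1 * y k.+1))%:R = x k * y k.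
Proof.
rewrite -(padic_compat x k) -(padic_compat y k) -natrM; apply/esym/padic_redP.
by rewrite /= modn_mod.
Qed.

Fact padic_opp_compat x k :
  (nat_of_ord (- x k.+1))%:R = - x k.
Proof.
apply/eqP; rewrite -subr_eq0 opprK -[X in _ + X](padic_compat x k) -natrD.
have -> : 0 = (nat_of_ord (0 : 'Z_(p ^ k.+2)))%:R :> 'Z_(p ^ k.+1) by [].
apply/eqP/padic_redP; rewrite /= modnDml subnK ?modnn ?mod0n //.
by rewrite ltnW.
Qed.

Definition padic_zero := PadicInt padic_zero_compat.
Definition padic_one := PadicInt padic_one_compat.
Definition padic_add x y := PadicInt (padic_add_compat x y).
Definition padic_mul x y := PadicInt (padic_mul_compat x y).
Definition padic_opp x := PadicInt (padic_opp_compat x).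

Fact padic_addA : associative padic_add.
Proof. by move=> x y z; apply: padic_ext => k /=; rewrite addrA. Qed.
Fact padic_addC : commutative padic_add.
Proof. by move=> x y; apply: padic_ext => k /=; rewrite addrC. Qed.
Fact padic_add0 : left_id padic_zero padic_add.
Proof. by move=> x; apply: padic_ext => k /=; rewrite add0r. Qed.
Fact padic_addN : left_inverse padic_zero padic_opp padic_add.
Proof. by move=> x; apply: padic_ext => k /=; rewrite addNr. Qed.
Fact padic_mulA : associative padic_mul.
Proof. by move=> x y z; apply: padic_ext => k /=; rewrite mulrA. Qed.
Fact padic_mulC : commutative padic_mul.
Proof. by move=> x y; apply: padic_ext => k /=; rewrite mulrC. Qed.
Fact padic_mul1 : left_id padic_one padic_mul.
Proof. by move=> x; apply: padic_ext => k /=; rewrite mul1r. Qed.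
Fact padic_mulDl : left_distributive padic_mul padic_add.
Proof. by move=> x y z; apply: padic_ext => k /=; rewrite mulrDl. Qed.
Fact padic_one_neq0 : padic_one != padic_zero.
Proof. by apply/eqP => /(congr1 (fun x : padic_int p => x 0)). Qed.

HB.instance Definition _ := GRing.isZmodule.Build (padic_int p)
  padic_addA padic_addC padic_add0 padic_addN.
HB.instance Definition _ := GRing.Zmodule_isComNzRing.Build (padic_int p)
  padic_mulA padic_mulC padic_mul1 padic_mulDl padic_one_neq0.

End PadicRing.

Section PadicTopology.
Variable p : nat.

(* The inverse limit (p-adic) topology: the cosets x + p^(k+1) Z_p are the
   basic neighbourhoods of x. *)
Definition padic_open (U : set (padic_int p)) :=
  forall x, U x -> exists k, forall y : padic_int p, y k = x k -> U y.

Lemma padic_proj_le (x y : padic_int p) k l :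
  (k <= l)%N -> y l = x l -> y k = x k.
Proof.
move=> /subnK <-; elim: (l - k)%N => // m IH.
by rewrite addSn => e; apply: IH; rewrite -(padic_compat y) -(padic_compat x) e.
Qed.

Fact padic_openT : padic_open setT.
Proof. by move=> x _; exists 0%N. Qed.

Fact padic_openI : setI_closed padic_open.
Proof.
move=> U V oU oV x [/oU [k kU] /oV [l lV]]; exists (maxn k l) => y e.
split; [apply: kU | apply: lV]; apply: padic_proj_le e.
  exact: leq_maxl.
exact: leq_maxr.
Qed.

Fact padic_open_bigU (I : Type) (f : I -> set (padic_int p)) :
  (forall i, padic_open (f i)) -> padic_open (\bigcup_i f i).
Proof.
move=> of_ x [i _ /of_ [k kf]].
by exists k => y e; exists i => //; apply: kf.
Qed.

HB.instance Definition _ := isOpenTopological.Build (padic_int p)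
  padic_openT padic_openI padic_open_bigU.
HB.instance Definition _ := isPointed.Build (padic_int p) 0.

End PadicTopology.

HB.instance Definition _ (p : nat) := Measurable.copy (padic_int p)
  (g_sigma_algebraType (@open (padic_int p))).

(* Translation invariance characterises Haar measure among Borel probability
   measures on the compact group Z_p. *)
Definition haar_probability (p : nat) (R : realType)
    (mu : probability (padic_int p) R) : Prop :=
  forall (a : padic_int p) (A : set (padic_int p)),
    measurable A -> mu [set a + x | x in A] = mu A.

Definition haar_distributed (p : nat) (R : realType) (d : measure_display)
    (T : measurableType d) (P : probability T R) (Y : T -> padic_int p) : Prop :=
  exists2 mu : probability (padic_int p) R, haar_probability mu &
    forall A : set (padic_int p), measurable A -> P (Y @^-1` A) = mu A.

Definition mutually_independent (d d' : measure_display)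
    (T : measurableType d) (T' : measurableType d') (R : realType)
    (P : probability T R) (I : finType) (D : pred I) (Y : I -> T -> T') : Prop :=
  forall (J : {set I}) (A : I -> set T'),
    (forall i, i \in J -> D i) -> (forall i, i \in J -> measurable (A i)) ->
    P (\bigcap_(i in [set i | i \in J]) (Y i @^-1` A i)) =
      (\prod_(i in J) P (Y i @^-1` A i))%E.

(* The j-th entry of Sigma is the support of the j-th column of X. *)
Definition haar_random_matrix (p n : nat) (Sigma : n.-tuple {set 'I_n})
    (R : realType) (d : measure_display) (T : measurableType d)
    (P : probability T R) (X : T -> 'M[padic_int p]_n) : Prop :=
  [/\ forall i j, measurable_fun setT (fun w => X w i j),
      forall i j, i \notin tnth Sigma j -> forall w, X w i j = 0,
      forall i j, i \in tnth Sigma j -> haar_distributed P (fun w => X w i j)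
    & mutually_independent P
        (fun ij : 'I_n * 'I_n => ij.1 \in tnth Sigma ij.2)
        (fun ij w => X w ij.1 ij.2)].

Section Cokernel.
Variables (R : comNzRingType) (n : nat) (A : 'M[R]_n).

Definition col_image : {pred 'cV[R]_n} :=
  fun u => `[< exists v : 'cV[R]_n, u = A *m v >].

Fact col_image_zmod_closed : zmod_closed col_image.
Proof.
split=> [|u v /asboolP [x ->] /asboolP [y ->]]; apply/asboolP.
  by exists 0; rewrite mulmx0.
by exists (x - y); rewrite mulmxBr.
Qed.

HB.instance Definition _ :=
  GRing.isZmodClosed.Build 'cV[R]_n col_image col_image_zmod_closed.

Definition cok : zmodType := Quotient.quot col_image.

End Cokernel.

Definition zmod_isog (V : zmodType) (gT : finGroupType) (H : {group gT}) : Prop :=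
  exists f : V -> gT,
    [/\ {morph f : x y / x + y >-> (x * y)%g}, injective f
      & range f = [set h | h \in H]].

Definition CL_constant (p : nat) (R : realType) : R :=
  lim ((fun m : nat => \prod_(1 <= i < m.+1) (1 - (p%:R : R) ^- i)) @ \oo).

Definition cok_converges_to_CL (p : nat) (R : realType)
    (d : nat -> measure_display) (T : forall n, measurableType (d n))
    (P : forall n, probability (T n) R)
    (X : forall n, T n -> 'M[padic_int p]_n) : Prop :=
  forall (gT : finGroupType) (H : {group gT}), abelian H -> (p.-group H)%g ->
    P n [set w | zmod_isog (cok (X n w)) H] @[n --> \oo] -->
      ((#|Aut H|%:R)^-1 * CL_constant p R)%:E.

(* Main.v *)
(* Only the trivial group is needed: cok(X_n) = 0 holds with probability tending to
   c = prod_i (1 - p^-i).  This event says that X_n mod p is invertible over F_p.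
   Reveal the columns of X_n mod p one at a time.  When m independent columns have
   been found, the next one, uniform on F_p^s, falls in their span with probability
   at least max(p^-#|s|, p^(m-n)).  Using the second bound for the last K columns
   and the first one for the others,
     P(cok(X_n) = 0) <= prod_(i <= K) (1 - p^-i) * exp(- S / 2)
   where S = sum_j p^-#|s_j|, after choosing an order of the columns in which the
   last K carry at most half of S.  If |Sigma_n|/n - log_p n < B for infinitely many
   n, then S >= p^-B by convexity, and for K large this keeps P(cok(X_n) = 0) below
   c * exp(- p^-B / 4) for infinitely many n. *)

Require Import Defs.
From HB Require Import structures.
From mathcomp Require Import all_boot all_order all_algebra all_fingroup all_solvable.
From mathcomp Require Import all_classical all_reals all_analysis.
From mathcomp Require Import mxabelem ring lra.

Set Implicit Arguments.
Unset Strict Implicit.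
Unset Printing Implicit Defensive.

Import Order.TTheory GRing.Theory Num.Theory.
Import numFieldNormedType.Exports.

(** * Counting full-rank matrices over a finite field whose rows have prescribed supports *)

Section SupportedMatrices.
Local Open Scope ring_scope.
Variable F : finFieldType.
Local Notation q := #|F|.

Definition supp_rows n (s : {set 'I_n}) : {set 'rV[F]_n} :=
  [set u : 'rV[F]_n | [forall j, (j \notin s) ==> (u 0 j == 0)]].

Lemma supp_rowsP n (s : {set 'I_n}) (u : 'rV[F]_n) :
  reflect (forall j, j \notin s -> u 0 j = 0) (u \in supp_rows s).
Proof.
rewrite inE; apply: (iffP forallP) => [H j js|H j].
  by have /implyP/(_ js)/eqP := H j.
by apply/implyP => /H ->.
Qed.

Fact supp_rows_group_set n (s : {set 'I_n}) : group_set (supp_rows s).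
Proof.
apply/group_setP; split=> [|u v /supp_rowsP Hu /supp_rowsP Hv].
  by apply/supp_rowsP => j _; rewrite mxE.
by apply/supp_rowsP => j js; rewrite mxE Hu // Hv // addr0.
Qed.
Canonical supp_rows_group n (s : {set 'I_n}) := Group (supp_rows_group_set s).

Lemma card_supp_rows n (s : {set 'I_n}) : #|supp_rows s| = (q ^ #|s|)%N.
Proof.
rewrite -(card_pffun_on 0 s F).
have row_inj : injective (fun f : {ffun 'I_n -> F} => \row_j f j).
  by move=> f g /rowP fg; apply/ffunP => j; have := fg j; rewrite !mxE.
rewrite -(card_imset _ row_inj); apply: eq_card => u.
apply/supp_rowsP/imsetP => [Hu|[f /pffun_onP[/supportP f0 _] ->] j js].
  exists [ffun j => u 0 j]; last by apply/rowP => j; rewrite mxE ffunE.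
  apply/pffun_onP; split=> [|y _]; last by [].
  by apply/supportP => j js; rewrite ffunE Hu.
by rewrite mxE f0.
Qed.

(** Supports are put on rows, although those of [X n] sit on columns, so that spans are the row
    spaces [rowg]; the reduced matrix is transposed when the two meet. *)
Definition supp_mx m n (s : 'I_m -> {set 'I_n}) : {set 'M[F]_(m, n)} :=
  [set A : 'M[F]_(m, n) | [forall i, row i A \in supp_rows (s i)]].

Definition free_supp_mx m n (s : 'I_m -> {set 'I_n}) : {set 'M[F]_(m, n)} :=
  [set A in supp_mx s | row_free A].

Lemma row_free_col_mx m n (u : 'rV[F]_n) (A : 'M[F]_(m, n)) :
  row_free (col_mx u A) -> row_free A && (u \notin rowg A).
Proof.
rewrite mem_rowg => uA_free; have rk_uA : \rank (u + A)%MS = m.+1.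
  by rewrite addsmxE (eqP uA_free).
apply/andP; split.
  rewrite -row_leq_rank -ltnS -rk_uA (leq_trans (mxrank_adds_leqif u A)) //.
  by rewrite -[X in (_ <= X)%N]add1n leq_add2r rank_leq_row.
apply/negP => /addsmx_idPr sub_uA; have := rank_leq_row A.
by rewrite -sub_uA rk_uA ltnn.
Qed.

(** The top row is revealed last: it has to avoid the span of the rows below it, and together with
    them it determines the matrix. *)
Lemma card_free_supp_mxS m n (s : 'I_m.+1 -> {set 'I_n}) :
  (#|free_supp_mx s| <=
     \sum_(A in free_supp_mx (s \o lift ord0))
        #|supp_rows (s ord0) :\: rowg A|)%N.
Proof.
have drowE (B : 'M[F]_(1 + m, n)) i : row i (dsubmx B) = row (lift ord0 i) B.
  by apply/rowP => j; rewrite !mxE; congr (B _ _); apply: val_inj.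
have urowE (B : 'M[F]_(1 + m, n)) : usubmx B = row ord0 B.
  by apply/rowP => j; rewrite !mxE; congr (B _ _); apply: val_inj.
have splitP (B : 'M[F]_(1 + m, n)) : B \in free_supp_mx s ->
    dsubmx B \in free_supp_mx (s \o lift ord0) /\
    usubmx B \in supp_rows (s ord0) :\: rowg (dsubmx B).
  rewrite inE => /andP[]; rewrite inE => /forallP supB freeB.
  have /andP[freeA uA] : row_free (dsubmx B) && (usubmx B \notin rowg (dsubmx B)).
    by apply: row_free_col_mx; rewrite vsubmxK.
  split; last by rewrite inE uA urowE supB.
  by rewrite 2!inE freeA andbT; apply/forallP => i; rewrite drowE; apply: supB.
rewrite -sum1_card (partition_big (fun B : 'M[F]_(1 + m, n) => dsubmx B)
  [in free_supp_mx (s \o lift ord0)]) /=; last by move=> B /splitP[].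
apply: leq_sum => A _; rewrite sum1dep_card.
rewrite -(@card_in_imset _ _ (fun B : 'M[F]_(1 + m, n) => usubmx B)).
  apply/subset_leq_card/fintype.subsetP => u /imsetP[B]; rewrite inE.
  by move=> /andP[/splitP[_ uB] /eqP <-] ->.
move=> B C; rewrite !inE => /andP[_ /eqP dB] /andP[_ /eqP dC] uBC.
by rewrite -[B]vsubmxK -[C]vsubmxK dB dC uBC.
Qed.

Variable R : realFieldType.

(* The span of the rows already chosen meets the coordinate subspace in at least
   the zero vector, and in codimension at most that of the span. *)
Lemma card_supp_rowsD m n (s : {set 'I_n}) (A : 'M[F]_(m, n)) : row_free A ->
  #|supp_rows s :\: rowg A|%:R <=
    q%:R ^+ #|s| * (1 - Num.max (q%:R ^- #|s|) (q%:R ^- (n - m))) :> R.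
Proof.
move=> freeA; have q_gt0 : 0 < q%:R :> R by rewrite ltr0n ltnW // card_finNzRing_gt1.
have le_mn : (m <= n)%N by rewrite -(eqP freeA) rank_leq_col.
have cardI : (#|supp_rows s :\: rowg A| + #|supp_rows s :&: rowg A| = q ^ #|s|)%N.
  by rewrite addnC cardsID card_supp_rows.
have -> : #|supp_rows s :\: rowg A|%:R =
    q%:R ^+ #|s| - #|supp_rows s :&: rowg A|%:R :> R.
  by rewrite -natrX -cardI natrD addrK.
rewrite mulrBr mulr1 lerD2l lerN2 mulrC -ler_pdivlMr ?exprn_gt0 //.
rewrite ge_max; apply/andP; split; last first.
  rewrite ler_pdivlMr ?exprn_gt0 // mulrC ler_pdivrMr ?exprn_gt0 //.
  rewrite -(ler_pM2r (exprn_gt0 m q_gt0)) -mulrA -[X in _ <= _ * X]exprD subnK //.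
  rewrite -!natrX -!natrM ler_nat -[in (q ^ m)%N](eqP freeA) -card_rowg.
  (* [mul_cardG] trades the intersection for the product set, which has at most [q ^ n] elements. *)
  rewrite -card_supp_rows mul_cardG mulnC leq_mul2l.
  by rewrite (leq_trans (max_card _)) ?orbT // card_mx mul1n.
rewrite -[leLHS]mul1r ler_pM2r ?invr_gt0 ?exprn_gt0 // ler1n.
exact: cardG_gt0 (supp_rows_group s :&: rowg_group A)%G.
Qed.

(** Row [i] is revealed after the [m - i.+1] rows below it, whose span has codimension
    [(n - m + i).+1]. *)
Lemma card_free_supp_mx m n (s : 'I_m -> {set 'I_n}) : (m <= n)%N ->
  #|free_supp_mx s|%:R <= \prod_(i < m) (q%:R ^+ #|s i| *
    (1 - Num.max (q%:R ^- #|s i|) (q%:R ^- (n - m + i).+1))) :> R.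
Proof.
elim: m s => [|m IHm] s le_mn.
  by rewrite big_ord0 lern1 (leq_trans (max_card _)) // card_mx mul0n.
rewrite big_ord_recl /=.
have {}IHm := IHm (s \o lift ord0) (ltnW le_mn).
apply: (@le_trans _ _ (#|free_supp_mx (s \o lift ord0)|%:R * (q%:R ^+ #|s ord0| *
    (1 - Num.max (q%:R ^- #|s ord0|) (q%:R ^- (n - m)))))).
  rewrite mulr_natl -[leRHS]sumr_const.
  apply: (@le_trans _ _ (\sum_(A in free_supp_mx (s \o lift ord0))
    #|supp_rows (s ord0) :\: rowg A|)%N%:R).
    by rewrite ler_nat card_free_supp_mxS.
  rewrite natr_sum; apply: ler_sum => A; rewrite inE => /andP[_ freeA].
  exact: card_supp_rowsD.
have -> : (n - m.+1 + 0).+1 = (n - m)%N by rewrite addn0 -subSn.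
rewrite mulrC; apply: ler_wpM2l.
  have q_ge1 : 1 <= q%:R :> R by rewrite ler1n ltnW // card_finNzRing_gt1.
  have q_gt0 := lt_le_trans ltr01 q_ge1.
  apply: mulr_ge0; first by rewrite exprn_ge0 ?ltW.
  rewrite subr_ge0 ge_max.
  by rewrite !invf_le1 ?exprn_gt0 // !exprn_ege1.
apply: le_trans IHm _; rewrite le_eqVlt; apply/orP; left; apply/eqP.
apply: eq_bigr => i _ /=; rewrite /bump /= add1n.
by rewrite -[(n - m)%N]subSS (subSn le_mn) addSnnS.
Qed.

Lemma row_perm_supp_mx m n (s : 'I_m -> {set 'I_n}) (t : 'S_m) A :
  (row_perm t A \in supp_mx (s \o t)) = (A \in supp_mx s).
Proof.
have rowE i : row i (row_perm t A) = row (t i) A.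
  by apply/rowP => j; rewrite !mxE.
rewrite !inE; apply/forallP/forallP => H i; last by rewrite rowE H.
by have := H (t^-1 i)%g; rewrite rowE /= permKV.
Qed.

(** The bound above depends on the order of the rows while the count does not, so the order can be
    chosen freely. *)
Lemma card_free_supp_mx_perm m n (s : 'I_m -> {set 'I_n}) (t : 'S_m) :
  #|free_supp_mx (s \o t)| = #|free_supp_mx s|.
Proof.
have row_perm_inj : injective (@row_perm F m n t).
  by move=> A B /(congr1 (row_perm t^-1)); rewrite -!row_permM !mulVg !row_perm1.
rewrite -(card_preimset _ row_perm_inj); apply: eq_card => A.
rewrite inE [LHS]finset.in_set [RHS]finset.in_set row_perm_supp_mx; congr (_ && _).
by rewrite row_permE /row_free eqmxMfull // row_full_unit unitmx_perm.
Qed.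

End SupportedMatrices.

Local Open Scope classical_set_scope.
Local Open Scope ring_scope.

(** * Density of the invertible matrices among those with given supports *)

Section SupportedDensity.
Variables (F : finFieldType) (R : realType).
Local Notation q := #|F|.

(** The rows [i < K] are the last to be revealed, and for them the codimension term of the maximum
    is kept; for the others the support term is kept, with [1 - x <= expR (- x)]. *)
Lemma free_supp_mx_density n (s : 'I_n -> {set 'I_n}) K : (K <= n)%N ->
  #|free_supp_mx F s|%:R / q%:R ^+ (\sum_i #|s i|) <=
    \prod_(1 <= i < K.+1) (1 - q%:R ^- i) *
    expR (- \sum_(i < n | (K <= i)%N) q%:R ^- #|s i|) :> R.
Proof.
move=> le_Kn; have q_ge1 : 1 <= q%:R :> R by rewrite ler1n ltnW // card_finNzRing_gt1.
have q_gt0 := lt_le_trans ltr01 q_ge1.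
have qV_le1 i : q%:R ^- i <= 1 :> R by rewrite invf_le1 ?exprn_gt0 // exprn_ege1.
rewrite ler_pdivrMr ?exprn_gt0 //.
apply: le_trans (card_free_supp_mx F R s (leqnn n)) _.
rewrite subnn big_split /= -expr_sum mulrC ler_wpM2r ?exprn_ge0 ?(ltW q_gt0) //.
rewrite (bigID (fun i : 'I_n => (i < K)%N)) /=.
apply: ler_pM; rewrite ?prodr_ge0 //.
- by move=> i _; rewrite subr_ge0 ge_max !qV_le1.
- by move=> i _; rewrite subr_ge0 ge_max !qV_le1.
- rewrite big_add1 /= big_mkord (big_ord_widen n (fun i => 1 - q%:R ^- i.+1)) //.
  apply: ler_prod => i _; rewrite subr_ge0 ge_max !qV_le1 /= lerD2l lerN2.
  by rewrite add0n le_max lexx orbT.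
rewrite -sumrN expR_sum (eq_bigl (fun i : 'I_n => (K <= i)%N)).
  apply: ler_prod => i _; rewrite subr_ge0 ge_max !qV_le1 /=.
  apply: le_trans (expR_ge1Dx _); rewrite lerD2l lerN2.
  by rewrite le_max lexx.
by move=> i; rewrite -leqNgt.
Qed.

(* Every index is at least [K] either in the given order of the rows or in the
   reversed one, so one of the two orders catches half of the sum. *)
Lemma free_supp_mx_density_half n (s : 'I_n -> {set 'I_n}) K : (K.*2 <= n)%N ->
  #|free_supp_mx F s|%:R / q%:R ^+ (\sum_i #|s i|) <=
    \prod_(1 <= i < K.+1) (1 - q%:R ^- i) *
    expR (- (\sum_i q%:R ^- #|s i|) / 2) :> R.
Proof.
move=> le_Kn; have le_K : (K <= n)%N by rewrite (leq_trans _ le_Kn) // -addnn leq_addr.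
have q_ge1 : 1 <= q%:R :> R by rewrite ler1n ltnW // card_finNzRing_gt1.
have q_gt0 := lt_le_trans ltr01 q_ge1.
have qV_le1 i : q%:R ^- i <= 1 :> R by rewrite invf_le1 ?exprn_gt0 // exprn_ege1.
have prod_ge0 : 0 <= \prod_(1 <= i < K.+1) (1 - q%:R ^- i) :> R.
  by rewrite prodr_ge0 // => i _; rewrite subr_ge0.
pose t := perm (@rev_ord_inj n).
have tE i : t i = rev_ord i by rewrite permE.
pose a i : R := q%:R ^- #|s i|.
have a_ge0 i : 0 <= a i by rewrite invr_ge0 exprn_ge0 // ltW.
have sum_le : \sum_i a i <= \sum_(i < n | (K <= i)%N) a i
                          + \sum_(i < n | (K <= i)%N) a (t i).
  rewrite (bigID (fun i : 'I_n => (K <= i)%N)) /= lerD2l.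
  rewrite [leRHS](reindex_inj (@rev_ord_inj n)) /=.
  rewrite [leRHS]big_mkcond [leLHS]big_mkcond /=; apply: ler_sum => i _.
  rewrite tE rev_ordK -ltnNge; case: ltnP => [lt_iK|_]; last by case: ifP.
  (* Here [K.*2 <= n] enters: reversal sends [i < K] to [n - i.+1 >= K]. *)
  rewrite ifT // leq_subRL ?ltn_ord // addSn.
  by rewrite (leq_trans _ le_Kn) // -addnn -addSn leq_add2r.
have [le1|lt1] := leP ((\sum_i a i) / 2) (\sum_(i < n | (K <= i)%N) a i).
  apply: le_trans (free_supp_mx_density s le_K) _.
  by rewrite ler_wpM2l // ler_expR mulNr lerN2.
have -> : (\sum_i #|s i| = \sum_i #|(s \o t) i|)%N.
  by rewrite (reindex_inj (@perm_inj _ t)).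
rewrite -(card_free_supp_mx_perm F s t).
apply: le_trans (free_supp_mx_density (s \o t) le_K) _.
rewrite ler_wpM2l // ler_expR mulNr lerN2 -/(a _).
change ((\sum_i a i) / 2 <= \sum_(i < n | (K <= i)%N) a (t i)).
lra.
Qed.
End SupportedDensity.

(** * Convergence and positivity of the infinite product *)

Section CohenLenstraConstant.
Variable R : realType.
Implicit Types p : nat.

Definition CL_prod p (m : nat) : R := \prod_(1 <= i < m.+1) (1 - p%:R ^- i).

(* The summand [2 ^- m.+1] is what makes the induction on [m] go through. *)
Lemma CL_prod_lbound p m : (1 < p)%N -> (0 < m)%N ->
  1 / 4 + 2 ^- m.+1 <= CL_prod p m.
Proof.
move=> p_gt1; have pV i : (p%:R : R) ^- i <= 2 ^- i.
  by rewrite lef_pV2 ?posrE ?exprn_gt0 ?ltr0n ?(ltnW p_gt1) // lerXn2r ?nnegrE ?ler_nat.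
elim: m => // -[_ _|m /(_ isT) IH _].
  by rewrite /CL_prod big_nat1; have := pV 1%N; rewrite !expr1 !exprS expr0 mulr1; lra.
rewrite /CL_prod big_nat_recr //= -/(CL_prod p m.+1).
have := pV m.+2; set x := p%:R ^- _ => x_le.
have y_ge0 : 0 <= 2 ^- m.+2 :> R by rewrite invr_ge0 exprn_ge0.
(* With [y = 2 ^- m.+2], the induction step needs [(1 / 4 + y) * (1 - y) >= 1 / 4 + y / 2], which
   for [y >= 0] follows from [y <= 1 / 4]. *)
have y_le : 2 ^- m.+2 <= 1 / 4 :> R.
  rewrite mul1r lef_pV2 ?posrE ?exprn_gt0 // (_ : 4 = 2 ^+ 2); last by rewrite -natrX.
  by rewrite ler_weXn2l // ler1n.
have -> : 2 ^- m.+3 = 2 ^- m.+2 / 2 :> R by rewrite [in LHS]exprSr invfM.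
move: x_le y_ge0 y_le IH; set y := 2 ^- m.+2; set v := CL_prod p m.+1 => *; nra.
Qed.

(** [CL_constant] is a [lim], informative only once convergence is known; the partial products
    decrease and stay above [1 / 4]. *)
Lemma CL_prod_cvg p : (1 < p)%N -> CL_prod p @ \oo --> CL_constant p R.
Proof.
move=> p_gt1; have u_ge m : 1 / 4 <= CL_prod p m.
  case: m => [|m]; first by rewrite /CL_prod big_nil; lra.
  apply: le_trans (CL_prod_lbound p_gt1 (ltn0Sn m)).
  by rewrite lerDl invr_ge0 exprn_ge0.
apply: (@nonincreasing_is_cvgn R (CL_prod p)).
  apply/nonincreasing_seqP => m; rewrite /CL_prod [leLHS]big_nat_recr //=.
  rewrite ler_piMr ?gerBl ?invr_ge0 ?exprn_ge0 //.
  by apply: le_trans (u_ge m); lra.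
by exists (1 / 4) => _ [m _ <-].
Qed.

(** Positivity is what separates the constant from its multiples by factors close to 1 in the final
    contradiction. *)
Lemma CL_constant_gt0 p : (1 < p)%N -> 0 < CL_constant p R.
Proof.
move=> p_gt1; apply: (@lt_le_trans _ _ (1 / 4)); first lra.
apply: limr_ge; first exact: CL_prod_cvg.
exists 1%N => // -[] // m _; apply: le_trans (CL_prod_lbound p_gt1 (ltn0Sn m)).
by rewrite lerDl invr_ge0 exprn_ge0.
Qed.

End CohenLenstraConstant.

(** * Reduction modulo p and the probability of a trivial cokernel *)

Lemma measure_finset d (T : measurableType d) (R : realType)
    (mu : {measure set T -> \bar R}) (I : finType) (D : {set I}) (F : I -> set T) :
  trivIset setT F -> (forall i, measurable (F i)) ->
  mu (\bigcup_(i in [set i | i \in D]) F i) = (\sum_(i in D) mu (F i))%E.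
Proof.
move=> Ftriv Fm; rewrite -[RHS]big_enum fsbig_seq ?enum_uniq //.
rewrite -measure_fin_bigcup //; last by apply: sub_trivIset Ftriv.
by congr (mu _); apply: eq_bigcupl; split=> i /=; rewrite mem_enum.
Qed.

Section PadicReduction.
Variables (p : nat) (p_pr : prime p).
Implicit Types x y : padic_int p.

(** The component of index 0 lives in ['Z_(p ^ 1)] and is carried to the field ['F_p] through [nat].
    The primality argument lets the morphism instances, whose proofs use it, be attached to the
    function. *)
Definition padic_red of prime p := fun x => (nat_of_ord (x 0%N))%:R : 'F_p.
Local Notation red := (padic_red p_pr).

Let Zp1_cast : (Zp_trunc (p ^ 1)).+2 = p.
Proof. by rewrite expn1 Zp_cast // prime_gt1. Qed.

Fact padic_red_zmod_morphism : zmod_morphism red.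
Proof.
move=> x y; apply/eqP; rewrite eq_sym subr_eq; apply/eqP.
rewrite -[in LHS](subrK y x); move: (x - y) => z.
by rewrite /padic_red /= [X in (_ %% X)%N]Zp1_cast Fp_nat_mod // natrD.
Qed.

Fact padic_red_monoid_morphism : monoid_morphism red.
Proof.
split=> [//|x y].
by rewrite /padic_red /= [X in (_ %% X)%N]Zp1_cast Fp_nat_mod // natrM.
Qed.

HB.instance Definition _ := GRing.isZmodMorphism.Build (padic_int p) 'F_p red
  padic_red_zmod_morphism.
HB.instance Definition _ := GRing.isMonoidMorphism.Build (padic_int p) 'F_p red
  padic_red_monoid_morphism.

Lemma padic_red_surj (a : 'F_p) : red (nat_of_ord a)%:R = a.
Proof. by rewrite rmorph_nat natr_Zp. Qed.

Lemma open_padic_red (A : set 'F_p) : open (red @^-1` A).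
Proof.
by move=> x Ax; exists 0%N => y yx; rewrite /= /padic_red yx.
Qed.

Lemma measurable_padic_red (A : set 'F_p) : measurable (red @^-1` A).
Proof. by apply: sub_sigma_algebra; apply: open_padic_red. Qed.

Let pX_gt1 k : (1 < p ^ k.+1)%N.
Proof. by rewrite -(exp1n k.+1) ltn_exp2r // prime_gt1. Qed.

(** By compatibility the residue can be read at every level, which makes each component of an
    element with nonzero residue prime to [p]. *)
Lemma padic_red_proj x k : red x = (nat_of_ord (x k))%:R.
Proof.
elim: k => // k ->; have -> : nat_of_ord (x k) = (x k.+1 %% p ^ k.+1)%N.
  by rewrite -(padic_compat x k) Zp_nat /= [X in (_ %% X)%N](Zp_cast (pX_gt1 k)).
rewrite -[LHS](Fp_nat_mod p_pr) -[RHS](Fp_nat_mod p_pr).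
by rewrite modn_dvdm // dvdn_exp.
Qed.

(** Each component is invertible modulo [p ^ k.+1], and the inverses are compatible because inverses
    are unique. *)
Lemma padic_red_unit x : red x != 0 -> exists y, x * y = 1.
Proof.
move=> x_neq0; have x_unit k : x k \is a GRing.unit.
  have -> : x k = (nat_of_ord (x k))%:R by rewrite natr_Zp.
  rewrite unitZpE // coprime_pexpl // prime_coprime //.
  move: x_neq0; rewrite (padic_red_proj x k); apply: contraNN => /dvdnP[c ->].
  by rewrite natrM pchar_Fp_0 // mulr0.
have inv_compat k : (nat_of_ord (x k.+1)^-1)%:R = (x k)^-1.
  apply: (mulrI (x_unit k)); rewrite (mulrV (x_unit k)).
  rewrite -[X in X * _](padic_compat x k) -natrM.
  apply: (@padic_redP p k _ 1); rewrite -[in RHS](mulrV (x_unit k.+1)) /=.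
  by rewrite modn_mod.
exists (PadicInt inv_compat); apply: padic_ext => k /=.
exact: mulrV (x_unit k).
Qed.

(** Both sides say that [\det A] is a unit. A trivial cokernel yields a right inverse of [A], column
    by column; conversely, a unit determinant lets the adjugate solve [u = A *m v] for every [u]. *)
Lemma cok_trivialP n (A : 'M[padic_int p]_n) (gT : finGroupType) :
  zmod_isog (cok A) [1 gT] <-> map_mx red A \in unitmx.
Proof.
rewrite unitmxE unitfE det_map_mx; split=> [[f [_ f_inj f_rng]]|/padic_red_unit[d dK]].
  have imA (u : 'cV_n) : exists v, u = A *m v.
    have f1 z : f z = 1%g.
      have : range f (f z) by exists z.
      by rewrite f_rng /= => /set1P.
    have : (\pi u : cok A)%qT = (\pi 0 : cok A)%qT by apply: f_inj; rewrite !f1.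
    by move/eqP; rewrite -Quotient.idealrBE subr0 => /asboolP.
  have /choice[v vE] j := imA (col j 1%:M).
  pose B := \matrix_(i, j) v j i 0.
  have AB1 : A *m B = 1%:M.
    apply/matrixP => i j; have /colP/(_ i) := vE j; rewrite !mxE => ->.
    by apply: eq_bigr => k _; rewrite mxE.
  move/(congr1 (fun M => red (\det M))): AB1; rewrite det_mulmx det1 rmorph1 rmorphM.
  by move=> AB1; apply: contra_eqN AB1 => /eqP ->; rewrite mul0r eq_sym oner_eq0.
have cok0 (z : cok A) : z = (\pi 0 : cok A)%qT.
  elim/quotW: z => u; apply/eqP; rewrite -Quotient.idealrBE subr0; apply/asboolP.
  exists (d *: \adj A *m u).
  by rewrite mulmxA -scalemxAr mul_mx_adj scale_scalar_mx mulrC dK mul1mx.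
exists (fun=> 1%g); split=> [x y|x y _|].
- by rewrite mulg1.
- by rewrite (cok0 x) (cok0 y).
by apply/seteqP; split=> [_ [z _ <-]|g /set1P ->] /=; [rewrite inE | exists 0].
Qed.

(** The [p] residue classes partition the space and are translates of one another, so they share the
    mass 1 equally. *)
Lemma haar_residue (R : realType) (mu : probability (padic_int p) R) (a : 'F_p) :
  haar_probability mu -> mu (red @^-1` [set a]) = (p%:R^-1)%:E.
Proof.
move=> mu_haar; have mu_eq b : mu (red @^-1` [set b]) = mu (red @^-1` [set 0]).
  rewrite -[RHS](mu_haar (nat_of_ord b)%:R); last exact: measurable_padic_red.
  congr (mu _); apply/seteqP; split=> [x /= xb|_ [x /= x0 <-]].
    exists (x - (nat_of_ord b)%:R); last by rewrite addrC subrK.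
    by rewrite /= rmorphB /= padic_red_surj xb subrr.
  by rewrite /= rmorphD /= padic_red_surj x0 addr0.
have triv : trivIset setT (fun b : 'F_p => red @^-1` [set b]).
  by move=> b c _ _ [x [/= -> ->]].
have := measure_finset mu [set: 'F_p]%SET triv (fun b => measurable_padic_red [set b]).
rewrite (_ : \bigcup_(b in _) _ = setT); last first.
  by apply/seteqP; split=> // x _; exists (red x); rewrite //= inE.
rewrite [LHS](probability_setT mu) (eq_bigr _ (fun b _ => mu_eq b)) (mu_eq a).
have /fineK <- : mu (red @^-1` [set 0]) \is a fin_num.
  by apply: (fin_num_measure mu); apply: measurable_padic_red.
rewrite sumEFin sumr_const cardsT card_Fp // => -[pm1]; congr EFin.
have p_neq0 : p%:R != 0 :> R by rewrite pnatr_eq0 -lt0n prime_gt0.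
by apply: (mulfI p_neq0); rewrite mulr_natl -pm1 mulfV.
Qed.

End PadicReduction.

(** The event is the disjoint union, over the invertible matrices [M] with the right supports, of
    the events that the transposed reduction of [X] is [M]; all of these have the same
    probability. *)
Lemma prob_cok_trivial (p n : nat) (p_pr : prime p) (Sigma : n.-tuple {set 'I_n})
    (R : realType) (d : measure_display) (T : measurableType d)
    (P : probability T R) (X : T -> 'M[padic_int p]_n) (gT : finGroupType) :
  haar_random_matrix Sigma P X ->
  P [set w | zmod_isog (cok (X w)) [1 gT]] =
    (#|free_supp_mx 'F_p (tnth Sigma)|%:R /
       p%:R ^+ (\sum_i #|tnth Sigma i|))%:E.
Proof.
move=> [Xm X0 Xhaar Xind]; pose red := padic_red p_pr.
pose E (M : 'M['F_p]_n) := [set w | (map_mx red (X w))^T = M].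
pose Eij (M : 'M['F_p]_n) (ij : 'I_n * 'I_n) :=
  (fun w => X w ij.1 ij.2) @^-1` (red @^-1` [set M ij.2 ij.1]).
have EijE M w : E M w <-> forall ij, Eij M ij w.
  split=> [EM [i j]|EM].
    by rewrite /Eij /= -EM !mxE.
  by apply/matrixP => j i; have := EM (i, j); rewrite /Eij /= => <-; rewrite !mxE.
have Eijm M ij : measurable (Eij M ij).
  rewrite -[X in measurable X]setTI; apply: Xm => //.
  exact: measurable_padic_red.
have Em M : measurable (E M).
  have -> : E M = \bigcap_(ij in [set: 'I_n * 'I_n]) Eij M ij.
    apply/seteqP; split=> [w /EijE EM ij _|w EM]; first exact: EM.
    by apply/EijE => ij; apply: EM.
  by apply: fin_bigcap_measurable.
have Etriv : trivIset setT E by move=> M N _ _ [w [/= <- <-]].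
pose J := [set ij : 'I_n * 'I_n | ij.1 \in tnth Sigma ij.2]%SET.
have cardJ : #|J| = (\sum_i #|tnth Sigma i|)%N.
  transitivity (\sum_j \sum_(i in tnth Sigma j) 1)%N; last first.
    by apply: eq_bigr => j _; rewrite sum1_card.
  have swap_inj : injective (fun x : 'I_n * 'I_n => (x.2, x.1)).
    by move=> [i j] [k l] [-> ->].
  rewrite pair_big_dep -sum1_card (reindex_inj swap_inj) /=.
  by apply: eq_bigl => x; rewrite inE.
have probE M : M \in free_supp_mx 'F_p (tnth Sigma) ->
    P (E M) = (p%:R ^- (\sum_i #|tnth Sigma i|))%:E.
  rewrite 2!inE => /andP[/forallP suppM _].
  (* Independence covers only the entries in the support. The other conditions hold automatically,
     since both matrices vanish there. *)
  have -> : E M = \bigcap_(ij in [set ij | ij \in J]) Eij M ij.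
    apply/seteqP; split=> [w /EijE EM ij _|w EM]; first exact: EM.
    apply/EijE => -[i j]; have [ijJ|] := boolP ((i, j) \in J); first exact: EM.
    rewrite inE /= => ij; rewrite /Eij /= X0 // /red rmorph0.
    by have /supp_rowsP/(_ _ ij) := suppM j; rewrite mxE.
  rewrite (Xind J (fun ij => red @^-1` [set M ij.2 ij.1])); first last.
  - by move=> ij _; apply: measurable_padic_red.
  - by move=> ij; rewrite inE.
  rewrite (eq_bigr (fun=> (p%:R^-1)%:E)) => [|ij].
    by rewrite prodEFin prodr_const cardJ exprVn.
  rewrite inE => /Xhaar[mu mu_haar ->]; last exact: measurable_padic_red.
  exact: haar_residue.
have -> : [set w | zmod_isog (cok (X w)) [1 gT]] =
    \bigcup_(M in [set M | M \in free_supp_mx 'F_p (tnth Sigma)]) E M.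
  apply/seteqP; split=> [w /(cok_trivialP p_pr) Xw|w [M MD EM]].
    exists (map_mx red (X w))^T => //=.
    rewrite 2!inE row_free_unit unitmx_tr Xw andbT; apply/forallP => j.
    by apply/supp_rowsP => i ij; rewrite !mxE X0 // /red rmorph0.
  apply/(cok_trivialP p_pr); rewrite -unitmx_tr -row_free_unit.
  by move: MD; rewrite /= -EM inE => /andP[].
rewrite measure_finset // (eq_bigr _ probE) sumEFin sumr_const.
by rewrite mulr_natl.
Qed.

(** * Convexity and the limit *)

(** Each term is bounded below by the tangent line of the exponential at [- (b * c)]; the linear
    parts add up to something nonnegative. *)
Lemma sum_expR_ge (R : realType) (I : finType) (a : I -> R) (b c : R) : 0 <= c ->
  \sum_i a i <= #|I|%:R * b ->
  #|I|%:R * expR (- (b * c)) <= \sum_i expR (- (a i * c)).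
Proof.
move=> c_ge0 sum_le.
apply: (@le_trans _ _ (\sum_i expR (- (b * c)) * (1 + (b - a i) * c))).
  rewrite -mulr_sumr mulrC ler_pM2l ?expR_gt0 // big_split /= sumr_const.
  rewrite lerDl -mulr_suml mulr_ge0 // sumrB sumr_const subr_ge0.
  by rewrite -[leRHS]mulr_natl.
apply: ler_sum => i _.
have -> : - (a i * c) = - (b * c) + (b - a i) * c by ring.
by rewrite expRD ler_pM2l ?expR_gt0 // expR_ge1Dx.
Qed.

Theorem theorem4p1 (R : realType) (p : nat) (p_prime : prime p)
    (Sigma : forall n : nat, n.-tuple {set 'I_n})
    (d : nat -> measure_display) (T : forall n : nat, measurableType (d n))
    (P : forall n : nat, probability (T n) R)
    (X : forall n : nat, T n -> 'M[padic_int p]_n)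
    (X_haar : forall n : nat, (0 < n)%N ->
       haar_random_matrix (Sigma n) (P n) (X n))
    (X_CL : cok_converges_to_CL P X) :
  (\sum_(i < n) #|tnth (Sigma n) i|)%N%:R / n%:R - ln n%:R / ln p%:R
    @[n --> \oo] --> (+oo : set_system R).
Proof.
apply/cvgryPge => B.
have p_gt1 := prime_gt1 p_prime.
have pR_gt0 : 0 < p%:R :> R by rewrite ltr0n prime_gt0.
have lnp_gt0 : 0 < ln p%:R :> R by rewrite ln_gt0 // ltr1n.
pose c : R := CL_constant p R.
have c_gt0 : 0 < c := CL_constant_gt0 R p_gt1.
pose eps : R := expR (- (B * ln p%:R)).
have eps_gt0 : 0 < eps := expR_gt0 _.
(* This excess factor [expR (eps / 4)], multiplied by the factor [expR (- eps / 2)] of the density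
   bound, leaves exactly [expR (- (eps / 4))]. *)
have [K K_lt] : exists K, CL_prod R p K < c * expR (eps / 4).
  have lt_c : c < c * expR (eps / 4) by rewrite ltr_pMr // expR_gt1; lra.
  exact: filter_ex (cvgr_lt _ (@CL_prod_cvg R p p_gt1) _ lt_c).
(* The trivial group needs an ambient [finGroupType]; [{perm 'I_1}] serves. *)
pose S n := [set w | zmod_isog (cok (X n w)) [1 {perm 'I_1}]%G].
have /fine_cvgP[_ P_cvg] : P n (S n) @[n --> \oo] --> c%:E.
  have := X_CL _ [1 {perm 'I_1}]%G (abelian1 _) (pgroup1 _ _).
  by rewrite Aut1 cards1 invr1 mul1r.
have gt_c : c * expR (- (eps / 4)) < c by rewrite gtr_pMr // expR_lt1; lra.
have P_gt := cvgr_gt _ P_cvg _ gt_c.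
near=> n; rewrite leNgt; apply/negP => small.
have n_gt0 : (0 < n)%N by near: n; exists 1%N.
have K_le : (K.*2 <= n)%N by near: n; exists K.*2.
have nR_gt0 : 0 < n%:R :> R by rewrite ltr0n.
have : c * expR (- (eps / 4)) < fine (P n (S n)) by near: n; exact: P_gt.
rewrite /S (prob_cok_trivial p_prime _ (X_haar n n_gt0)) /= => density_gt.
have := @free_supp_mx_density_half 'F_p R n (tnth (Sigma n)) K K_le.
rewrite card_Fp // -/(CL_prod R p K) => density_le.
(* [small] bounds the mean support size by [b = B + ln n / ln p]. Convexity with [c = ln p] bounds
   the sum below by [n * expR (- (b * c))], which is [eps]. *)
have sum_ge : eps <= \sum_i p%:R ^- #|tnth (Sigma n) i|.
  have := @sum_expR_ge R 'I_n (fun i => #|tnth (Sigma n) i|%:R)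
    (B + ln n%:R / ln p%:R) (ln p%:R) (ltW lnp_gt0).
  have -> : eps = n%:R * expR (- ((B + ln n%:R / ln p%:R) * ln p%:R)).
    rewrite mulrDl divfK ?gt_eqF // opprD expRD (expRN (ln _)) lnK ?posrE //.
    by rewrite mulrC divfK ?gt_eqF.
  rewrite card_ord -natr_sum => sum_ge; apply: le_trans (sum_ge _) _.
    by rewrite mulrC -ler_pdivrMr // ltW // -ltrBlDr.
  apply: ler_sum => i _; rewrite mulr_natl -lnXn // -lnV ?posrE ?exprn_gt0 //.
  by rewrite lnK // posrE invr_gt0 exprn_gt0.
have := lt_le_trans density_gt density_le; apply/negP; rewrite -leNgt.
apply: (@le_trans _ _ (CL_prod R p K * expR (- eps / 2))).
  apply: ler_wpM2l.
    rewrite prodr_ge0 // => i _; rewrite subr_ge0 invf_le1 ?exprn_gt0 //.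
    by rewrite exprn_ege1 // ler1n ltnW.
  by rewrite ler_expR ler_pM2r // lerN2.
have -> : - (eps / 4) = eps / 4 + - eps / 2 by field.
by rewrite expRD mulrA ler_pM2r ?expR_gt0 // ltW.
Unshelve. all: by end_near.
Qed.
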